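(* Let $G$ be a countable abelian group and suppose $A,B\subset G$ satisfy $$d^*(AB)\le K\cdot d^*(B)$$ for some $K$. Then $$d^*(A^k)\le K^k\cdot d^*(B)\qquad\text{for all } k\ge1.$$ In particular, for every integer $k\ge 1$, we have $$d^*(AB)\ge d^*(A^k)^{\frac1k}\cdot d^*(B)^{1-\frac1k}$$ for all $A,B\subset G$.
   Context: For $A,B\subset G$, $AB=\{ab: a\in A, b\in B\}$, and $A^k$ is the $k$-fold product set of $A$ with itself. A mean on $G$ is a positive norm-one linear functional on $\ell^\infty(G)$; for a mean $\lambda$ put $\lambda'(C)=\lambda(\chi_C)$, $C\subset G$, where $\chi_C$ is the indicator function of $C$. $\mathcal{L}_G$ is the set of all translation-invariant means on $G$. The upper Banach density of $C\subset G$ is $d^*(C)=\sup_{\lambda\in\mathcal{L}_G}\lambda'(C)$.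
   Formalization: The first claim assumes d*(B)>0 (it fails for G=ℤ, B={0}, A the squares, k=4, where d*(AB)=d*(B)=0 but d*(A^4)=1); in the second claim B is assumed nonempty when k=1 (with 0^0=1 it fails for B empty, A=G). *)

(* Defs.v *)
From HB Require Import structures.
From mathcomp Require Import all_boot all_order all_algebra.
From mathcomp Require Import all_classical all_reals all_analysis.
Import Order.TTheory GRing.Theory Num.Theory.
Import numFieldNormedType.Exports.

Set Implicit Arguments.
Unset Strict Implicit.
Unset Printing Implicit Defensive.

Local Open Scope classical_set_scope.
Local Open Scope ring_scope.

Section linfty_pred.
Variables (T : Type) (R : realType).

Definition linfty_pred : {pred T -> R^o} :=
  [pred f : T -> R^o | `[< bounded_fun f >]].

Lemma linfty_predP (f : T -> R^o) :
  reflect (exists M : R, forall x, `|f x| <= M) (f \in linfty_pred).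
Proof.
rewrite inE; apply: (iffP (asboolP _)) => [|[M fM]].
  by move=> /pinfty_ex_gt0[M _ fM]; exists M => x; exact: fM.
exists M; split; first exact: num_real.
by move=> N /ltW MN x _; exact: le_trans (fM x) MN.
Qed.

Lemma linfty_submod_closed : submod_closed linfty_pred.
Proof.
split; first by apply/linfty_predP; exists 0 => x; rewrite normr0.
move=> a f g /linfty_predP[M fM] /linfty_predP[N gN].
apply/linfty_predP; exists (`|a| * M + N) => x /=.
rewrite (le_trans (ler_normD _ _))// lerD// normrZ.
exact: ler_wpM2l.
Qed.

HB.instance Definition _ :=
  GRing.isSubmodClosed.Build R (T -> R^o) linfty_pred linfty_submod_closed.

End linfty_pred.
Arguments linfty_pred : clear implicits.

(* the real Banach space of bounded functions T -> R, with the sup norm *)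
Record linfty (T : Type) (R : realType) := Linfty {
  linfty_val : T -> R^o ;
  linfty_valP : linfty_val \in linfty_pred T R }.

Section linfty_module.
Variables (T : Type) (R : realType).

HB.instance Definition _ := [isSub for @linfty_val T R].
HB.instance Definition _ := [Choice of linfty T R by <:].
HB.instance Definition _ := [SubChoice_isSubLmodule of linfty T R by <:].

End linfty_module.

Definition linfty_fun (T : Type) (R : realType) (f : linfty T R) : T -> R :=
  linfty_val f.
Coercion linfty_fun : linfty >-> Funclass.

Section linfty_norm.
Variables (T : Type) (R : realType).
Implicit Types f g : linfty T R.

Definition linfty_norm f : R := sup [set `|f x| | x in [set: T]].

Lemma linfty_norm_ub f x : `|f x| <= linfty_norm f.
Proof.
apply: ub_le_sup; last by exists x.
have /linfty_predP[M fM] := linfty_valP f.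
by exists M => _ [y _ <-]; exact: fM.
Qed.

Lemma linfty_norm_ge0 f : 0 <= linfty_norm f.
Proof.
have [T0|/set0P[x _]] := eqVneq [set: T] set0.
  by rewrite /linfty_norm T0 image_set0 sup0.
exact: le_trans (linfty_norm_ub f x).
Qed.

Lemma linfty_norm_le f (M : R) :
  0 <= M -> (forall x, `|f x| <= M) -> linfty_norm f <= M.
Proof.
move=> M0 fM; rewrite /linfty_norm.
have [->|/set0P[x _]] := eqVneq [set: T] set0; first by rewrite image_set0 sup0.
by apply: ge_sup => [|_ [y _ <-]//]; exists `|f x|, x.
Qed.

Lemma linfty_normD f g : linfty_norm (f + g) <= linfty_norm f + linfty_norm g.
Proof.
apply: linfty_norm_le => [|x]; first by rewrite addr_ge0 ?linfty_norm_ge0.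
by rewrite (le_trans (ler_normD _ _))// lerD ?linfty_norm_ub.
Qed.

Let linfty_normZ_le (a : R) f : linfty_norm (a *: f) <= `|a| * linfty_norm f.
Proof.
apply: linfty_norm_le => [|x]; first by rewrite mulr_ge0 ?linfty_norm_ge0.
by rewrite [leLHS]normrM ler_wpM2l ?linfty_norm_ub.
Qed.

Lemma linfty_normZ (a : R) f : linfty_norm (a *: f) = `|a| * linfty_norm f.
Proof.
apply/eqP; rewrite eq_le linfty_normZ_le /=.
have [->|a0] := eqVneq a 0; first by rewrite normr0 mul0r linfty_norm_ge0.
rewrite -ler_pdivlMl ?normr_gt0// -normfV.
by rewrite -{1}[f](scalerK a0) linfty_normZ_le.
Qed.

Lemma linfty_norm_eq0 f : linfty_norm f = 0 -> f = 0.
Proof.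
move=> f0; apply/val_inj/funext => x; apply/eqP.
by rewrite -normr_le0 -f0; exact: linfty_norm_ub.
Qed.

HB.instance Definition _ := Lmodule_isNormed.Build R (linfty T R)
  linfty_normD linfty_normZ linfty_norm_eq0.

Lemma indic_linfty (C : set T) : (\1_C : T -> R^o) \in linfty_pred T R.
Proof.
by apply/linfty_predP; exists 1 => x; rewrite indicE normr_nat lern1 leq_b1.
Qed.

Definition linfty_indic (C : set T) : linfty T R := Linfty (indic_linfty C).

End linfty_norm.

(* As [sup] of an unbounded set is 0, an unbounded functional gets the value 0;
   it is therefore excluded by [opnorm l = 1]. *)
Definition opnorm (R : realType) (V : normedModType R)
    (l : {linear V -> R^o}) : R :=
  sup [set `|l v| | v in [set v : V | `|v| <= 1]].

(* Abelian groups are written additively: the product set AB is A + B, the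
   k-fold product set A^k is the k-fold sumset. *)
Section density.
Variables (R : realType) (G : zmodType).
Implicit Types A B C : set G.

Lemma translate_linfty (g : G) (f : linfty G R) :
  ((fun x => f (g + x)) : G -> R^o) \in linfty_pred G R.
Proof.
have /linfty_predP[M fM] := linfty_valP f.
by apply/linfty_predP; exists M => x; exact: fM.
Qed.

Definition translate (g : G) (f : linfty G R) : linfty G R :=
  Linfty (translate_linfty g f).

Definition mean (l : {linear linfty G R -> R^o}) : Prop :=
  (forall f : linfty G R, (forall x, 0 <= f x) -> 0 <= l f) /\ opnorm l = 1.

Definition invariant_means : set {linear linfty G R -> R^o} :=
  [set l | mean l /\ forall g f, l (translate g f) = l f].

Definition upper_Banach_density C : R :=
  sup [set (l (linfty_indic R C) : R) | l in invariant_means].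

Definition sumset A B : set G := [set a + b | a in A & b in B].

Definition iter_sumset A (k : nat) : set G := iter k (sumset A) [set 0].

End density.

(* Main.v *)
Require Import Defs.
From HB Require Import structures.
From mathcomp Require Import all_boot all_order all_algebra.
From mathcomp Require Import all_classical all_reals all_analysis.
From mathcomp Require Import ring lra.
Import Order.TTheory GRing.Theory Num.Theory.
Import numFieldNormedType.Exports.
Local Open Scope classical_set_scope.
Local Open Scope ring_scope.

Set Implicit Arguments.
Unset Strict Implicit.
Unset Printing Implicit Defensive.

(** The proof transports Petridis' form of Pluennecke's inequality from finite
    sets to invariant means.

    Fix K with d*(A+B) < K d*(B), and for an invariant positive functional l
    and a set X put g(X) = K l(X) - l(A+X).  Since A + (U :&: W) lies inside
    both A + U and A + W, g is supermodular, and it is translation-invariant.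
    Suppose that X maximizes g among its own subsets.  Adding a translate c+X
    to a finite union U of translates changes g by at least
    g(c+X) - g(U :&: (c+X)) >= 0, so g(X+F) >= 0, that is
    l(A+X+F) <= K l(X+F), for all finite F ([surplus_translates_ge0]).  By
    induction l(X+F) <= K^k l(X) for every finite F inside kA
    ([measure_of_translates_le]).

    Means are only finitely additive and kA may be infinite, so X+kA cannot be
    measured through the sets X+F in general.  It can when l is an extreme
    invariant mean: then d*(C) <= sup_F l(X+F), F ranging over the finite
    subsets of C, as soon as l(X) > 0 ([extreme_mean_covering]).  Indeed for
    an invariant mean eta, v |-> eta(a |-> l(v 1_(a+X))) is invariant and
    dominated by l on nonnegative functions, hence equals l(X) l; on the other
    hand its value at the indicator of a nearly optimal X+F is almost at least
    eta(C) l(X), since for a in C the translate a+X sticks out of X+F by a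
    negligible amount only.

    Both a maximizing X and an extreme l are thus needed, together with
    0 < l(X) <= d*(B).  On G itself the supremum of g over subsets of B need
    not be attained.  Instead, the mean and the set are optimized at once:
    means live on G x set G, with G acting on the first factor, and X is the
    universal subset of B, the set of all (x, Y) with x in B and in Y.
    Maximizing g(X) over all invariant means l is the maximization of a linear
    form, so it is attained at an extreme l.  A subset Z of X is the preimage
    of X under an equivariant map of G x set G, so comparing l with its image
    under that map gives g(Z) <= g(X).

    The extreme maximizer is produced by [extreme_maximizer], a purely
    algebraic Krein-Milman theorem proved by applying Zorn's lemma to
    sublinear functionals.  Finally the case of equality
    d*(A+B) = K d*(B) follows by approaching K from above, and the inequality
    with k-th roots is the choice K = d*(A+B)/d*(B), up to the degenerate case
    d*(B) = 0. *)

(** * Extreme maximizers of linear forms *)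

Section LinearOf.
Variables (R : realType) (V : lmodType R) (f : V -> R^o) (f_lin : linear f).

Definition linear_of : {linear V -> R^o} :=
  HB.pack f (GRing.isLinear.Build R V R^o *:%R f f_lin).

End LinearOf.

Section ExtremeFunctional.
Variables (R : realType) (V : lmodType R).
Implicit Types (p q : V -> R) (u v w : V) (f : {linear V -> R^o}).

Definition sublinear p :=
  (forall u v, p (u + v) <= p u + p v) /\
  (forall t v, 0 <= t -> p (t *: v) <= t * p v).

Lemma sublinear0 {p} : sublinear p -> p 0 = 0.
Proof.
case=> pD pZ; have := pD 0 0; have := pZ 0 0 (lexx _).
by rewrite scale0r addr0; lra.
Qed.

Lemma sublinearN {p} v : sublinear p -> - p (- v) <= p v.
Proof.
move=> sp; have := sp.1 v (- v); rewrite subrr (sublinear0 sp); lra.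
Qed.

Lemma sublinearZ {p} t v : sublinear p -> 0 <= t -> p (t *: v) = t * p v.
Proof.
move=> sp; rewrite le_eqVlt => /predU1P[<-|t0].
  by rewrite scale0r mul0r (sublinear0 sp).
apply/eqP; rewrite eq_le (sp.2 _ _ (ltW t0))/= -ler_pdivlMl//.
have := sp.2 t^-1 (t *: v); rewrite scalerA mulVf ?gt_eqF// scale1r; apply.
by rewrite invr_ge0 ltW.
Qed.

(** A sublinear q <= p stands for the compact convex set of linear forms below
    it; [facial p q] says that this set is a face of the one below p.  A convex
    combination of forms l1, l2 below p is written as f1 + f2 with fi = ti li,
    so that weights equal to 0 need no separate treatment. *)
Definition facial p q := forall f1 f2 (t1 t2 : R),
  0 <= t1 -> 0 <= t2 -> t1 + t2 = 1 ->
  (forall v, f1 v <= t1 * p v) -> (forall v, f2 v <= t2 * p v) ->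
  (forall v, (f1 v : R) + f2 v <= q v) -> forall v, f1 v <= t1 * q v.

(** The support functional of the face of forms l <= q with l w = q w. *)
Definition exposed q w v : R :=
  inf [set q (v + t *: w) - t * q w | t in [set t | 0 <= t]].

Lemma exposed_has_lbound q w v : sublinear q ->
  has_lbound [set q (v + t *: w) - t * q w | t in [set t : R | 0 <= t]].
Proof.
move=> sq; exists (- q (- v)) => _ [t t0 <-].
have := sq.1 (v + t *: w) (- v).
by rewrite addrAC subrr add0r (sublinearZ _ sq t0); lra.
Qed.

Lemma exposed_le q w v t : sublinear q -> 0 <= t ->
  exposed q w v <= q (v + t *: w) - t * q w.
Proof. by move=> sq t0; apply: ge_inf; [exact: exposed_has_lbound|exists t]. Qed.

Lemma le_exposed q w v c :
  (forall t, 0 <= t -> c <= q (v + t *: w) - t * q w) -> c <= exposed q w v.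
Proof.
move=> cq; apply: lb_le_inf => [|_ [t /cq ct <-]//].
by exists (q (v + 0 *: w) - 0 * q w), 0 => //=.
Qed.

Lemma exposed_le_self q w v : sublinear q -> exposed q w v <= q v.
Proof.
by move=> sq; have := exposed_le w v sq (lexx 0); rewrite scale0r addr0 mul0r subr0.
Qed.

Lemma exposedN q w : sublinear q -> exposed q w (- w) <= - q w.
Proof.
move=> sq; have := exposed_le w (- w) sq ler01.
by rewrite scale1r addNr mul1r (sublinear0 sq) add0r.
Qed.

Lemma sublinear_exposed q w : sublinear q -> sublinear (exposed q w).
Proof.
move=> sq; split=> [u v|c v].
  rewrite -lerBlDr; apply: le_exposed => s s0.
  rewrite lerBlDl -lerBlDr; apply: le_exposed => t t0.
  rewrite lerBlDr; apply: le_trans (exposed_le _ _ sq (addr_ge0 s0 t0)) _.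
  have := sq.1 (u + s *: w) (v + t *: w).
  by rewrite addrACA -scalerDl; lra.
rewrite le_eqVlt => /predU1P[<-|c0].
  rewrite scale0r mul0r; apply: le_trans (exposed_le_self _ _ sq) _.
  by rewrite (sublinear0 sq).
rewrite -ler_pdivrMl//; apply: le_exposed => t t0.
rewrite ler_pdivrMl//.
apply: le_trans (exposed_le _ _ sq (mulr_ge0 (ltW c0) t0)) _.
by rewrite -scalerA -scalerDr (sublinearZ _ sq (ltW c0)); lra.
Qed.

(** Being a face is transitive: if f1 + f2 attains the maximum q w, then so do
    both summands relative to their weights, because neither can exceed its
    share. *)
Lemma facial_exposed p q w :
  sublinear q -> facial p q -> facial p (exposed q w).
Proof.
move=> sq pq f1 f2 t1 t2 t10 t20 t12 f1p f2p fq v.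
have fq' x : (f1 x : R) + f2 x <= q x.
  by apply: le_trans (fq x) _; exact: exposed_le_self.
have f1q := pq _ _ _ _ t10 t20 t12 f1p f2p fq'.
have f2q x : f2 x <= t2 * q x.
  apply: (pq f2 f1 t2 t1) => //; first by rewrite addrC.
  by move=> y; rewrite addrC.
have fw : q w <= (f1 w : R) + f2 w.
  have := le_trans (fq (- w)) (exposedN w sq).
  by rewrite !linearN /= -[X in X <= _]/(- f1 w - f2 w : R); lra.
have f1w : t1 * q w <= f1 w.
  have := f2q w; have -> : t2 = 1 - t1 by lra.
  by move: fw; move: (f1 w : R) (f2 w : R) => a b; lra.
move: t10; rewrite le_eqVlt => /predU1P[t10|t10].
  by have := f1p v; rewrite -t10 !mul0r.
rewrite -ler_pdivrMl//; apply: le_exposed => t t0.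
rewrite ler_pdivrMl//.
have := f1q (v + t *: w); rewrite linearD linearZ /=.
rewrite -[_ + _]/((f1 v : R) + t * f1 w : R).
have : t * (t1 * q w) <= t * (f1 w : R) by rewrite ler_wpM2l.
by move: (f1 v : R) (f1 w : R) => a b; lra.
Qed.

(** In a chain, subadditivity survives the infimum because two members can be
    replaced by the smaller one; the lower bound - p (- v) keeps it finite. *)
Lemma sublinear_chain_inf p (A : set (V -> R)) : A !=set0 ->
  (forall q, A q -> sublinear q /\ forall v, q v <= p v) ->
  total_on A (fun q q' => forall v, q' v <= q v) ->
  exists2 q, sublinear q & (forall q', A q' -> forall v, q v <= q' v) /\
    forall v c, (forall q', A q' -> c <= q' v) -> c <= q v.
Proof.
move=> [q1 Aq1] Ap totA; pose q v := inf [set q' v | q' in A].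
have lb v : has_lbound [set q' v | q' in A].
  exists (- p (- v)) => _ [q' /Ap[sq' q'p] <-].
  by apply: le_trans (sublinearN v sq'); rewrite lerN2.
have qle q' : A q' -> forall v, q v <= q' v.
  by move=> Aq' v; apply: ge_inf => //; exists q'.
have leq v c : (forall q', A q' -> c <= q' v) -> c <= q v.
  move=> cA; apply: lb_le_inf => [|_ [q' /cA ? <-]//].
  by exists (q1 v), q1.
exists q => //; split=> [u v|c v c0].
  rewrite -lerBlDr; apply: (leq u) => qa Aqa.
  rewrite lerBlDl -lerBlDr; apply: (leq v) => qb Aqb.
  rewrite lerBlDr.
  have [ba|ab] := totA _ _ Aqa Aqb.
  - apply: le_trans (qle _ Aqb _) _; apply: le_trans ((Ap _ Aqb).1.1 _ _) _.
    by rewrite addrC lerD2l.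
  - apply: le_trans (qle _ Aqa _) _; apply: le_trans ((Ap _ Aqa).1.1 _ _) _.
    by rewrite addrC lerD2r.
move: c0; rewrite le_eqVlt => /predU1P[<-|c0].
  rewrite scale0r mul0r; apply: le_trans (qle _ Aq1 _) _.
  by rewrite (sublinear0 (Ap _ Aq1).1).
rewrite -ler_pdivrMl//; apply: leq => q' Aq'.
rewrite ler_pdivrMl//; apply: le_trans (qle _ Aq' _) _.
exact: (Ap _ Aq').1.2 (ltW c0).
Qed.

Lemma minimal_facial_sublinear p q0 : sublinear q0 -> facial p q0 ->
  exists q, [/\ sublinear q, facial p q, forall v, q v <= q0 v &
    forall q', sublinear q' -> facial p q' -> (forall v, q' v <= q v) -> q' = q].
Proof.
move=> sq0 pq0.
pose P q := [/\ sublinear q, facial p q & forall v, q v <= q0 v].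
pose le (a b : {q | P q}) := `[< forall v, sval b v <= sval a v >].
have [||||[q [sq pq qq0]] qmax] := @Zorn {q | P q} le.
- by move=> a; apply/asboolP.
- move=> a b c /asboolP ab /asboolP bc; apply/asboolP => v.
  exact: le_trans (bc v) (ab v).
- move=> [a Pa] [b Pb] /asboolP/= ab /asboolP/= ba; apply: eq_exist.
  by apply/funext => v; apply/eqP; rewrite eq_le ba ab.
- move=> A totA; have [[a0 Aa0]|A0] := pselect (A !=set0); last first.
    exists (exist P q0 (And3 sq0 pq0 (fun=> lexx _))) => a Aa.
    by exfalso; apply: A0; exists a.
  have [|||q sq [qle leq]] :=
      @sublinear_chain_inf q0 [set sval a | a in A].
  - by exists (sval a0), a0.
  - by move=> _ [[a [sa pa aq0]] _ <-].
  - move=> _ _ [a Aa <-] [b Ab <-].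
    by have [/asboolP|/asboolP] := totA _ _ Aa Ab; [left|right].
  have qq0 v : q v <= q0 v.
    apply: le_trans (qle (sval a0) _ v) _; first by exists a0.
    by case: (svalP a0).
  have pq : facial p q.
    move=> f1 f2 t1 t2 t10 t20 t12 f1p f2p fq v.
    move: (t10); rewrite le_eqVlt => /predU1P[t1E|t1_gt0].
      by have := f1p v; rewrite -t1E !mul0r.
    rewrite -ler_pdivrMl//; apply: leq => _ [[a [sa pa aq0]] Aa <-] /=.
    rewrite ler_pdivrMl//; apply: (pa f1 f2 t1 t2) => // x.
    by apply: le_trans (fq x) _; apply: qle; exists (exist P a (And3 sa pa aq0)).
  exists (exist P q (And3 sq pq qq0)) => a Aa; apply/asboolP => v /=.
  by apply: qle; exists a.
exists q; split=> // q' sq' pq' q'q.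
have Pq' : P q' by split=> // v; exact: le_trans (q'q v) (qq0 v).
have /(congr1 sval)//= := qmax (exist P q' Pq') (asboolT q'q).
Qed.

(** A minimal face consists of a single form, which means that its support
    functional is itself linear. *)
Lemma sublinear_odd_linear q : sublinear q -> (forall v, q (- v) <= - q v) ->
  linear (q : V -> R^o).
Proof.
move=> sq qN a u v.
have qNE x : q (- x) = - q x.
  by have := sublinearN x sq; have := qN x; lra.
have qD x y : q (x + y) = q x + q y.
  have := sq.1 x y; have := sq.1 (x + y) (- y).
  by rewrite addrK qNE; lra.
rewrite qD; congr (_ + _); have [a0|a0] := leP 0 a; first exact: sublinearZ.
rewrite -[a]opprK scaleNr qNE (sublinearZ _ sq) ?oppr_ge0 ?ltW//.
by rewrite [RHS]mulNr.
Qed.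

(** A minimal face inside the face where w is maximal is a point: exposing it
    in any direction v does not shrink it, which forces q (- v) <= - q v.
    Extremality is stated for decompositions into summands dominated by
    multiples of p, as in [facial]. *)
Theorem extreme_maximizer p w : sublinear p ->
  exists f, [/\ forall v, f v <= p v, f w = p w &
    forall f1 f2 (t1 t2 : R), 0 <= t1 -> 0 <= t2 -> t1 + t2 = 1 ->
      (forall v, f1 v <= t1 * p v) -> (forall v, f2 v <= t2 * p v) ->
      (forall v, f v = (f1 v : R) + f2 v) -> forall v, f1 v = t1 * f v].
Proof.
move=> sp; have se := sublinear_exposed w sp.
have pp : facial p p by move=> f1 f2 t1 t2 _ _ _ f1p.
have [q [sq pq qe qmin]] :=
  minimal_facial_sublinear se (facial_exposed (w := w) sp pp).
have qN v : q (- v) <= - q v.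
  rewrite -[X in X (- v)](qmin (exposed q v)) ?exposedN//.
  - exact: sublinear_exposed.
  - exact: facial_exposed.
  - by move=> u; exact: exposed_le_self.
have qp v : q v <= p v by apply: le_trans (qe v) _; exact: exposed_le_self.
pose f := linear_of (sublinear_odd_linear sq qN).
exists f; split=> //.
  apply/eqP; rewrite eq_le; apply/andP; split; first exact: qp.
  rewrite -lerN2 -[X in X <= _]linearN /=.
  exact: le_trans (qe _) (exposedN _ sp).
move=> f1 f2 t1 t2 t10 t20 t12 f1p f2p fE v.
have f1q x : f1 x <= t1 * f x.
  apply: (pq f1 f2 t1 t2) => // y.
  by rewrite -(fE y).
apply/eqP; rewrite eq_le f1q /=.
have := f1q (- v); rewrite !linearN /= -[X in X <= _]/(- f1 v : R).
by rewrite mulrN lerN2.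
Qed.

End ExtremeFunctional.

(** * Positive functionals on bounded functions *)

Section PositiveFunctionals.
Variables (R : realType) (T : Type).
Implicit Types (f : linfty T R) (l : {linear linfty T R -> R^o}) (C D : set T).

Lemma linfty_eqP f f' : (forall x, f x = f' x) -> f = f'.
Proof. by move=> ff'; apply/val_inj/funext. Qed.

Lemma linftyDE f f' x : (f + f') x = f x + f' x.
Proof. by []. Qed.

Lemma linftyNE f x : (- f) x = - f x.
Proof. by []. Qed.

Lemma linftyZE (a : R) f x : (a *: f) x = a * f x.
Proof. by []. Qed.

Lemma linfty_indicE C x : linfty_indic R C x = (x \in C)%:R.
Proof. by rewrite [LHS]indicE. Qed.

Definition linftyE := (linftyDE, linftyNE, linftyZE, linfty_indicE).

Definition positive l := forall f, (forall x, 0 <= f x) -> 0 <= l f.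

(** For positive l this is a finitely additive measure. *)
Definition measure_of l C : R := l (linfty_indic R C).

Lemma functional_homo l f f' : positive l ->
  (forall x, f x <= f' x) -> l f <= l f'.
Proof.
move=> lpos ff'; rewrite -subr_ge0 -[X in 0 <= X](linearB l) /=.
by apply: lpos => x; rewrite !linftyE subr_ge0.
Qed.

Lemma functional_norm_le l f : positive l ->
  `|l f| <= `|f| * measure_of l setT.
Proof.
move=> lpos.
have fx x : - `|f| <= f x <= `|f| by rewrite -ler_norml; exact: linfty_norm_ub.
have lE (a : R) : l (a *: linfty_indic R setT) = a * measure_of l setT.
  by rewrite linearZ.
rewrite ler_norml -mulNr -!lE; apply/andP; split; apply: functional_homo => // x;
by rewrite !linftyE in_setT mulr1; case/andP: (fx x).
Qed.

(** A positive functional has its norm attained at the constant 1, so the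
    norm-one condition on means is a normalization of the total mass. *)
Lemma opnorm_positive l : positive l -> [set: T] !=set0 ->
  opnorm l = measure_of l setT.
Proof.
move=> lpos [x0 _].
have l0 : 0 <= measure_of l setT.
  by apply: lpos => x; rewrite linfty_indicE ler0n.
have ub : ubound [set `|l v| | v in [set v | `|v| <= 1]] (measure_of l setT).
  move=> _ [v /= v1 <-]; apply: le_trans (functional_norm_le v lpos) _.
  by rewrite ler_piMl.
apply/eqP; rewrite eq_le; apply/andP; split.
  apply: ge_sup ub; exists `|l 0|, 0 => //=; first by rewrite normr0 ler01.
apply: ub_le_sup; first by exists (measure_of l setT).
exists (linfty_indic R setT); last by rewrite ger0_norm.
by apply: linfty_norm_le => // x; rewrite linfty_indicE in_setT normr1.
Qed.

Lemma measure_of_ge0 l C : positive l -> 0 <= measure_of l C.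
Proof. by apply=> x; rewrite linfty_indicE ler0n. Qed.

Lemma measure_of0 l : measure_of l set0 = 0.
Proof.
rewrite /measure_of (_ : linfty_indic R set0 = 0) ?linear0//.
by apply: linfty_eqP => x; rewrite linfty_indicE in_set0.
Qed.

Lemma le_measure_of l C D : positive l -> C `<=` D ->
  measure_of l C <= measure_of l D.
Proof.
move=> lpos CD; apply: functional_homo => // x.
rewrite !linfty_indicE ler_nat; case: (boolP (x \in C)) => // /set_mem/CD xD.
by rewrite mem_set.
Qed.

Lemma measure_ofU l C D :
  measure_of l (C `|` D) + measure_of l (C `&` D) =
  measure_of l C + measure_of l D.
Proof.
rewrite /measure_of -[LHS](linearD l) -[RHS](linearD l); congr (l _).
apply: linfty_eqP => x; rewrite !linftyE in_setU in_setI.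
by case: (x \in C); case: (x \in D); rewrite ?addr0 ?add0r.
Qed.

End PositiveFunctionals.

Section Pullback.
Variables (R : realType) (S T : Type) (h : S -> T).

Lemma pullback_linfty (f : linfty T R) :
  ((fun x => f (h x)) : S -> R^o) \in linfty_pred S R.
Proof.
have /linfty_predP[M fM] := linfty_valP f.
by apply/linfty_predP; exists M => x; exact: fM.
Qed.

Definition pullback (f : linfty T R) : linfty S R := Linfty (pullback_linfty f).

Lemma pullback_linear : linear pullback.
Proof. by move=> a f g; apply: linfty_eqP. Qed.

Lemma pullback_indic C : pullback (linfty_indic R C) = linfty_indic R (h @^-1` C).
Proof. by apply: linfty_eqP => x; rewrite linfty_indicE [LHS]linfty_indicE. Qed.

Variable l : {linear linfty S R -> R^o}.

Lemma pushforward_linear :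
  linear (fun f : linfty T R => l (pullback f) : R^o).
Proof. by move=> a f g; rewrite pullback_linear linearP. Qed.

Definition pushforward : {linear linfty T R -> R^o} :=
  linear_of pushforward_linear.

Lemma measure_of_pushforward C :
  measure_of pushforward C = measure_of l (h @^-1` C).
Proof. by rewrite /measure_of -pullback_indic. Qed.

Lemma positive_pushforward : positive l -> positive pushforward.
Proof. by move=> lpos f f0; apply: lpos => x; exact: f0. Qed.

End Pullback.

Section Cutoff.
Variables (R : realType) (T : Type).
Implicit Types (f : linfty T R) (C D : set T).

Lemma cutoff_linfty C f :
  ((fun x => f x * (x \in C)%:R) : T -> R^o) \in linfty_pred T R.
Proof.
have /linfty_predP[M fM] := linfty_valP f.
apply/linfty_predP; exists M => x; rewrite normrM normr_nat.
by case: (x \in C); rewrite ?mulr1 ?mulr0 ?fM//; exact: le_trans (fM x).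
Qed.

Definition cutoff C f : linfty T R := Linfty (cutoff_linfty C f).

Lemma cutoffE C f x : cutoff C f x = f x * (x \in C)%:R.
Proof. by []. Qed.

Lemma cutoff_linear C : linear (cutoff C).
Proof.
by move=> a f g; apply: linfty_eqP => x; rewrite !(linftyE, cutoffE); ring.
Qed.

Lemma cutoff_indic C D : cutoff C (linfty_indic R D) = linfty_indic R (D `&` C).
Proof.
apply: linfty_eqP => x; rewrite cutoffE !linfty_indicE in_setI.
by rewrite -natrM mulnb.
Qed.

Lemma cutoffC C f : cutoff C f + cutoff (~` C) f = f.
Proof.
apply: linfty_eqP => x; rewrite !(linftyE, cutoffE) in_setC.
by case: (x \in C); rewrite ?mulr0 ?mulr1 ?addr0 ?add0r.
Qed.

Lemma cutoff_ge0 C f : (forall x, 0 <= f x) -> forall x, 0 <= cutoff C f x.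
Proof. by move=> f0 x; rewrite cutoffE mulr_ge0. Qed.

Lemma norm_cutoff_le C f : `|cutoff C f| <= `|f|.
Proof.
apply: linfty_norm_le => // x; rewrite cutoffE normrM normr_nat.
case: (x \in C); rewrite ?mulr1 ?mulr0 ?normr_ge0//.
exact: linfty_norm_ub.
Qed.

End Cutoff.

(** * Petridis' inequality for invariant means *)

Section InvariantMeans.
Variables (R : realType) (G : zmodType) (I : Type).
Implicit Types (l : {linear linfty (G * I) R -> R^o}) (X U W : set (G * I)).
Implicit Types (A C : set G) (c g : G).

Definition act g (s : G * I) : G * I := (g + s.1, s.2).

Lemma actD g g' s : act g (act g' s) = act (g + g') s.
Proof. by rewrite /act /= addrA. Qed.

Definition invariant l := forall g f, l (pullback (act g) f) = l f.

Definition mean_on l :=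
  [/\ positive l, measure_of l setT = 1 & invariant l].

Definition shift c X : set (G * I) := act (- c) @^-1` X.

(** The sumset A + X inside G x I. *)
Definition thicken A X : set (G * I) := \bigcup_(a in A) shift a X.

Lemma measure_of_shift l c X : invariant l ->
  measure_of l (shift c X) = measure_of l X.
Proof. by move=> linv; rewrite /measure_of -pullback_indic linv. Qed.

Lemma shiftD c c' X : shift c (shift c' X) = shift (c + c') X.
Proof. by apply/funext => s; rewrite /shift /= actD opprD addrC. Qed.

Lemma thicken_shift A c X : thicken A (shift c X) = shift c (thicken A X).
Proof.
rewrite /thicken /shift preimage_bigcup; apply: eq_bigcupr => a _.
by rewrite -/(shift c X) -/(shift a X) -!/(shift _ _) !shiftD addrC.
Qed.

Lemma thicken_sumset A C X : thicken (sumset A C) X = thicken A (thicken C X).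
Proof.
apply/seteqP; split=> s.
  by move=> [_ [a Aa [c Cc <-]]]; rewrite -shiftD => Xs; exists a => //; exists c.
move=> [a Aa [c Cc]]; rewrite -[X in X -> _]/(shift a (shift c X) s) shiftD => Xs.
by exists (a + c) => //; exists a => //; exists c.
Qed.

Lemma thicken_cons c (F : seq G) X :
  thicken [set` c :: F] X = thicken [set` F] X `|` shift c X.
Proof.
rewrite setUC /thicken (_ : [set` c :: F] = c |` [set` F]) ?bigcup_setU1//.
by apply/seteqP; split=> g /=; rewrite inE => /predU1P.
Qed.

Lemma thickenS A U W : U `<=` W -> thicken A U `<=` thicken A W.
Proof. by move=> UW; apply: subset_bigcup => a _ s; exact: UW. Qed.

Lemma thickenU A U W : thicken A (U `|` W) = thicken A U `|` thicken A W.
Proof. by rewrite -bigcupU; apply: eq_bigcupr. Qed.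

(** The function g of the introduction; nonnegativity of [surplus l K A U]
    means that adding A multiplies the measure of U by at most K. *)
Definition surplus l (K : R) A U : R :=
  K * measure_of l U - measure_of l (thicken A U).

Lemma surplus_shift l K A c U : invariant l ->
  surplus l K A (shift c U) = surplus l K A U.
Proof. by move=> linv; rewrite /surplus thicken_shift !measure_of_shift. Qed.

Lemma surplus_supermodular l K A U W : positive l ->
  surplus l K A U + surplus l K A W <=
  surplus l K A (U `|` W) + surplus l K A (U `&` W).
Proof.
move=> lpos; rewrite /surplus thickenU.
have : measure_of l (thicken A (U `&` W)) <=
    measure_of l (thicken A U `&` thicken A W).
  by apply: le_measure_of => //; rewrite subsetI; split; apply: thickenS => s [].
have := measure_ofU l (thicken A U) (thicken A W).
have := congr1 ( *%R K) (measure_ofU l U W); lra.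
Qed.

(** By supermodularity, passing from U to U together with c+X gains at least
    the surplus of c+X minus that of its part inside U.  That part is a
    translate of a subset of X, hence the gain is nonnegative.  There is no
    restriction on the size of A. *)
Lemma surplus_translates_ge0 l K A X (F : seq G) : positive l -> invariant l ->
  (forall Z, Z `<=` X -> surplus l K A Z <= surplus l K A X) ->
  0 <= surplus l K A (thicken [set` F] X).
Proof.
move=> lpos linv Xmax; elim: F => [|c F IHF].
  rewrite set_nil /surplus /thicken bigcup_set0 bigcup0 => [|a _].
    by rewrite !measure_of0 mulr0 subr0.
  exact: preimage_set0.
rewrite thicken_cons.
set U := thicken _ _ in IHF *.
have := surplus_supermodular K A U (shift c X) lpos.
suff : surplus l K A (U `&` shift c X) <= surplus l K A (shift c X) by lra.
rewrite -(surplus_shift _ _ (- c)) // -[leRHS](surplus_shift _ _ (- c))//.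
rewrite [X in _ <= surplus _ _ _ X]shiftD addNr.
have shift0 : shift 0 X = X.
  by apply/funext => -[x i]; rewrite /shift /act /= oppr0 add0r.
rewrite shift0; apply: Xmax => s [_].
by rewrite -[X in X -> _]/(shift (- c) (shift c X) s) shiftD addNr shift0.
Qed.

(** A finite F inside (k+1)A lies in A + F' for some finite F' inside kA, one
    element of F' for each element of F. *)
Lemma measure_of_translates_le l K A X k (F : seq G) :
  positive l -> invariant l -> 0 <= K ->
  (forall Z, Z `<=` X -> surplus l K A Z <= surplus l K A X) ->
  [set` F] `<=` iter_sumset A k ->
  measure_of l (thicken [set` F] X) <= K ^+ k * measure_of l X.
Proof.
move=> lpos linv K0 Xmax; elim: k F => [|k IHk] F FA.
  rewrite expr0 mul1r; apply: le_measure_of => // -[x i] [c /FA ->].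
  by rewrite /shift /act /= oppr0 add0r.
have [F' F'A FF'] : exists2 F' : seq G,
    [set` F'] `<=` iter_sumset A k & [set` F] `<=` sumset A [set` F'].
  elim: F FA => [_|c F IHF FA]; first by exists [::].
  have [c' Fc'|F' F'A FF'] := IHF.
    by apply: FA => /=; rewrite inE; apply/orP; right.
  have [a Aa [b Ab abc]] : iter_sumset A k.+1 c.
    by apply: FA => /=; rewrite inE eqxx.
  exists (b :: F') => x /=; rewrite inE => /predU1P[->|].
  - exact: Ab.
  - exact: F'A.
  - by exists a => //; exists b => //=; rewrite inE eqxx.
  - move=> /FF'[a' Aa' [b' /= F'b' <-]].
    by exists a' => //; exists b' => //=; rewrite inE F'b' orbT.
have := surplus_translates_ge0 F' lpos linv Xmax.
rewrite /surplus subr_ge0 -thicken_sumset => /(le_trans _) le.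
apply: le_trans (le _ _) _.
  by apply: le_measure_of => // s [c Fc Xs]; exists c => //; exact: FF'.
by rewrite exprS -mulrA ler_wpM2l// IHk.
Qed.

End InvariantMeans.

(** * Extreme invariant means *)

Section ExtremeMeans.
Variables (R : realType) (G : zmodType) (I : Type).
Implicit Types (l : {linear linfty (G * I) R -> R^o}) (X Y : set (G * I)).
Implicit Types (v w : linfty (G * I) R).

(** Extremality in the form in which it is used: an invariant positive
    functional that l dominates is a multiple of l. *)
Definition extreme_mean l := mean_on l /\
  forall l1 l2, positive l1 -> invariant l1 -> positive l2 -> invariant l2 ->
    (forall v, l v = (l1 v : R) + l2 v) ->
    forall v, l1 v = measure_of l1 setT * l v.

(** The support functional of the convex set of invariant means. *)
Definition upper_mean v : R := sup [set (l v : R) | l in @mean_on R G I].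

Lemma mean_le_norm l v : mean_on l -> l v <= `|v|.
Proof.
move=> [lpos l1 _]; have := functional_norm_le v lpos.
by rewrite l1 mulr1; apply: le_trans; exact: ler_norm.
Qed.

Lemma le_upper_mean l v : mean_on l -> l v <= upper_mean v.
Proof.
move=> lm; apply: ub_le_sup; last by exists l.
by exists `|v| => _ [l' l'm <-]; exact: mean_le_norm.
Qed.

Lemma upper_mean_le v (c : R) : (exists l, mean_on l) ->
  (forall l, mean_on l -> l v <= c) -> upper_mean v <= c.
Proof.
move=> [l lm] vc; apply: ge_sup => [|_ [l' l'm <-]]; last exact: vc.
by exists (l v), l.
Qed.

Lemma sublinear_upper_mean : (exists l, mean_on l) -> sublinear upper_mean.
Proof.
move=> ex; split=> [u v|t v t0]; apply: upper_mean_le => // l lm.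
  by rewrite linearD; apply: lerD; exact: le_upper_mean.
by rewrite linearZ; apply: ler_wpM2l => //; exact: le_upper_mean.
Qed.

(** The conditions defining an invariant mean are linear equalities and
    inequalities, so they pass from all means to every form below their
    support functional. *)
Lemma dominated_by_upper_mean l : (exists l, mean_on l) ->
  (forall v, l v <= upper_mean v) -> mean_on l.
Proof.
move=> ex lp.
have lpN v (c : R) : (forall l', mean_on l' -> c <= l' v) -> c <= l v.
  move=> cv; rewrite -lerN2 -[X in X <= _](linearN l).
  apply: le_trans (lp _) (upper_mean_le ex _) => l' l'm.
  by rewrite linearN /= lerN2; exact: cv.
split=> [v v0||g v].
- by apply: lpN => l' [l'pos _ _]; exact: l'pos.
- apply/eqP; rewrite eq_le; apply/andP; split.
    by apply: le_trans (lp _) (upper_mean_le ex _) => l' [_ + _] => <-.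
  by apply: lpN => l' [_ + _]; rewrite /measure_of => ->.
- apply/eqP; rewrite -subr_eq0 -[X in X == _](linearB l).
  rewrite eq_le; apply/andP; split.
    apply: le_trans (lp _) (upper_mean_le ex _) => l' [_ _ l'inv].
    by rewrite linearB l'inv [X in X <= _]subrr.
  apply: lpN => l' [_ _ l'inv].
  by rewrite linearB l'inv [X in _ <= X]subrr.
Qed.

(** A functional of positive mass is a multiple of a mean, and one of mass 0
    vanishes, being bounded by its mass. *)
Lemma le_mass_upper_mean l v : positive l -> invariant l ->
  l v <= measure_of l setT * upper_mean v.
Proof.
move=> lpos linv; have := measure_of_ge0 setT lpos.
rewrite le_eqVlt => /predU1P[l0|l0].
  rewrite -l0 mul0r; apply: le_trans (ler_norm _) _.
  by apply: le_trans (functional_norm_le _ lpos) _; rewrite -l0 mulr0.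
rewrite -ler_pdivrMl//.
pose l' : {linear linfty (G * I) R -> R^o} := (measure_of l setT)^-1 \*: l.
apply: (@le_upper_mean l'); split=> [f f0||g f].
- by apply: mulr_ge0; [rewrite invr_ge0 ltW|exact: lpos].
- by rewrite /measure_of -[LHS]/(_^-1 * measure_of l setT) mulVf// gt_eqF.
- by rewrite /l' /= linv.
Qed.

Lemma extreme_mean_maximizer w : (exists l, mean_on l) ->
  exists2 l, extreme_mean l & forall l', mean_on l' -> l' w <= l w.
Proof.
move=> ex.
have [l [lp lw lext]] := extreme_maximizer w (sublinear_upper_mean ex).
have lm := dominated_by_upper_mean ex lp.
exists l; last by move=> l' l'm; rewrite lw; exact: le_upper_mean.
split=> // l1 l2 l1pos l1inv l2pos l2inv lE.
apply: (lext l1 l2 _ (measure_of l2 setT)) => //.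
- exact: measure_of_ge0.
- exact: measure_of_ge0.
- by case: lm => _ + _; rewrite /measure_of lE.
- by move=> v; exact: le_mass_upper_mean.
- by move=> v; exact: le_mass_upper_mean.
Qed.

Lemma cutoff_pullback_act g Y v :
  cutoff Y (pullback (act g) v) = pullback (act g) (cutoff (shift g Y) v).
Proof.
apply: linfty_eqP => -[x i]; rewrite cutoffE.
rewrite -[RHS]/(v (act g (x, i)) * (act g (x, i) \in shift g Y)%:R).
congr (_ * _); congr ((_ : bool)%:R); apply/idP/idP => /set_mem Y'; apply/mem_set.
  by rewrite /shift /= actD addNr /act /= add0r.
by move: Y'; rewrite /shift /= actD addNr /act /= add0r.
Qed.

(** For an equivariant family of sets Y a, averaging the restrictions of l to
    the Y a against an invariant mean of G gives a functional that is again
    positive and invariant. *)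
Section Average.
Variables (eta : {linear linfty G R -> R^o}) (l : {linear linfty (G * I) R -> R^o}).
Variable Y : G -> set (G * I).
Hypotheses (lpos : positive l) (linv : invariant l).
Hypotheses (etapos : positive eta).
Hypothesis etainv : forall g f, eta (translate g f) = eta f.
Hypothesis Yact : forall g a, shift g (Y a) = Y (g + a).

Lemma orbit_linfty v : ((fun a => l (cutoff (Y a) v)) : G -> R^o) \in linfty_pred G R.
Proof.
apply/linfty_predP; exists (`|v| * measure_of l setT) => a.
apply: le_trans (functional_norm_le _ lpos) _.
by rewrite ler_wpM2r ?measure_of_ge0// norm_cutoff_le.
Qed.

Definition orbit_fun v : linfty G R := Linfty (orbit_linfty v).

Lemma orbit_fun_linear : linear orbit_fun.
Proof.
move=> c u v; apply: linfty_eqP => a.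
by rewrite -[LHS]/(l (cutoff (Y a) _)) cutoff_linear linearP.
Qed.

Lemma average_linear : linear (fun v => eta (orbit_fun v) : R^o).
Proof. by move=> c u v; rewrite orbit_fun_linear linearP. Qed.

Definition average : {linear linfty (G * I) R -> R^o} := linear_of average_linear.

Lemma positive_average : positive average.
Proof. by move=> v v0; apply: etapos => a; apply: lpos; exact: cutoff_ge0. Qed.

Lemma invariant_average : invariant average.
Proof.
move=> g v; rewrite -[RHS]/(eta (orbit_fun v)) -[RHS](etainv g).
rewrite -[LHS]/(eta (orbit_fun _)); congr (eta _); apply: linfty_eqP => a.
rewrite -[LHS]/(l (cutoff (Y a) _)) cutoff_pullback_act linv.
by rewrite -[RHS]/(l (cutoff (Y (g + a)) v)) Yact.
Qed.

End Average.

(** The finite unions X + F, for F inside C, cannot be enlarged much once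
    l(X + F) is close to its supremum, so each a + X with a in C is almost
    contained in X + F, uniformly in a.  Averaging l over a + X with respect to
    eta gives l(X) l by extremality; comparing both at X + F bounds eta(C).  In
    effect an extreme mean is ergodic: its translates of X fill at least as
    much as the density of the set of translations used. *)
Lemma extreme_mean_covering (eta : {linear linfty G R -> R^o}) l X (C : set G) (M : R) :
  positive eta -> measure_of eta setT = 1 ->
  (forall g f, eta (translate g f) = eta f) ->
  extreme_mean l -> 0 < measure_of l X ->
  (forall F : seq G, [set` F] `<=` C -> measure_of l (thicken [set` F] X) <= M) ->
  measure_of eta C <= M.
Proof.
move=> etapos eta1 etainv [[lpos l1 linv] lext] X0 CM.
pose E := [set measure_of l (thicken [set` F] X) |
           F in [set F : seq G | [set` F] `<=` C]].
have Eub : ubound E M by move=> _ [F FC <-]; exact: CM.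
have E0 : E !=set0.
  by exists (measure_of l (thicken [set` [::]] X)), [::].
set m := measure_of l X in X0 *.
have key (e : R) : 0 < e -> measure_of eta C * (m - e) <= m * M.
  move=> e0; have [_ [F FC <-] Fe] := sup_adherent e0 (conj E0 (ex_intro _ _ Eub)).
  set U := thicken _ _ in Fe.
  have UX a : C a -> m - e <= measure_of l (U `&` shift a X).
    move=> Ca; have := measure_ofU l U (shift a X).
    rewrite (measure_of_shift _ _ linv) -thicken_cons.
    suff : measure_of l (thicken [set` a :: F] X) <= sup E by rewrite -/m; lra.
    apply: ub_le_sup; first by exists M.
    exists (a :: F) => // x /=; rewrite inE => /predU1P[->//|]; exact: FC.
  pose Y a := shift a X.
  have Yact g a : shift g (Y a) = Y (g + a) by rewrite /Y shiftD.
  have Yact' g a : shift g (~` Y a) = ~` Y (g + a) by rewrite -Yact.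
  pose l1' := average eta Y lpos.
  (* Averaging over the complements gives the rest of l, as extremality needs. *)
  pose l2' := average eta (fun a => ~` Y a) lpos.
  have eta_const c : eta (c *: linfty_indic R setT) = c.
    by rewrite -[RHS]mulr1 -[in RHS]eta1; exact: linearZ.
  have lE v : l v = (l1' v : R) + l2' v.
    rewrite -[RHS](linearD eta) -[LHS]eta_const; congr (eta _).
    apply: linfty_eqP => a; rewrite !linftyE in_setT mulr1.
    by rewrite -{1}(cutoffC (Y a) v) linearD.
  have l1E : l1' (linfty_indic R U) = m * measure_of l U.
    rewrite (lext l1' l2') => //; try exact: positive_average;
      try exact: invariant_average.
    congr (_ * _); rewrite -[RHS]eta_const; congr (eta _).
    apply: linfty_eqP => a; rewrite !linftyE in_setT mulr1.
    rewrite -[LHS]/(l (cutoff (Y a) _)) cutoff_indic setTI.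
    exact: measure_of_shift.
  have : m * measure_of l U <= m * M by rewrite ler_pM2l// CM.
  apply: le_trans; rewrite -l1E mulrC.
  have -> : (m - e) * measure_of eta C = eta ((m - e) *: linfty_indic R C).
    by apply: esym; exact: linearZ.
  apply: functional_homo => // a.
  rewrite !linftyE -[leRHS]/(l (cutoff (Y a) _)) cutoff_indic.
  have [/set_mem/UX|_] := boolP (a \in C); first by rewrite mulr1.
  by rewrite mulr0; exact: measure_of_ge0.
(* eta(C) <= 1 makes the error eta(C) e at most e. *)
have C1 : measure_of eta C <= 1 by rewrite -eta1; exact: le_measure_of.
rewrite -(ler_pM2l X0); apply/ler_addgt0Pr => e e0.
have := key e e0; rewrite mulrBr lerBlDr mulrC => /le_trans; apply.
by rewrite lerD2l ler_piMl// ltW.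
Qed.

End ExtremeMeans.

(** * Upper Banach density *)

Section UpperDensity.
Variables (R : realType) (G : zmodType).
Implicit Types (l : {linear linfty G R -> R^o}) (A B C : set G).

Lemma invariant_meansP l : invariant_means l <->
  [/\ positive l, measure_of l setT = 1 & forall g f, l (translate g f) = l f].
Proof.
have G0 : [set: G] !=set0 by exists 0.
split=> [[[lpos l1] linv]|[lpos l1 linv]].
  by split=> //; rewrite -l1 opnorm_positive.
by split=> //; split=> //; rewrite opnorm_positive.
Qed.

Lemma density_ge l C : invariant_means l ->
  measure_of l C <= upper_Banach_density R C.
Proof.
move=> lm; apply: ub_le_sup; last by exists l.
exists 1 => _ [l' /invariant_meansP[l'pos l'1 _] <-].
by rewrite -l'1; exact: le_measure_of.
Qed.

Lemma density_le C (c : R) : 0 <= c ->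
  (forall l, invariant_means l -> measure_of l C <= c) ->
  upper_Banach_density R C <= c.
Proof.
move=> c0 lc; have [[l lm]|] := pselect (@invariant_means R G !=set0).
  by apply: ge_sup => [|_ [l' l'm <-]]; [exists (measure_of l C), l|exact: lc].
move=> /set0P/negP/negPn/eqP nomean.
by rewrite /upper_Banach_density nomean image_set0 sup0.
Qed.

Lemma density_ge0 C : 0 <= upper_Banach_density R C.
Proof.
have [[l lm]|] := pselect (@invariant_means R G !=set0).
  apply: le_trans (density_ge C lm); apply: measure_of_ge0.
  by case/invariant_meansP: lm.
move=> /set0P/negP/negPn/eqP nomean.
by rewrite /upper_Banach_density nomean image_set0 sup0.
Qed.

Lemma density_sumset_ge A B : B !=set0 ->
  upper_Banach_density R A <= upper_Banach_density R (sumset A B).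
Proof.
move=> [b Bb]; apply: density_le; first exact: density_ge0.
move=> l lm; apply: le_trans (density_ge _ lm).
case/invariant_meansP: lm => lpos _ linv.
have -> : measure_of l A = measure_of l (+%R (- b) @^-1` A).
  rewrite -[LHS](linv (- b)); congr (l _).
  by rewrite -(pullback_indic R (+%R (- b))); exact: linfty_eqP.
apply: le_measure_of => // x /= Ax; exists (- b + x) => //; exists b => //.
by rewrite addrC addNKr.
Qed.

Lemma mean_on_section (I : Type) (i : I) l : invariant_means l ->
  mean_on (pushforward (fun x => (x, i)) l).
Proof.
move=> /invariant_meansP[lpos l1 linv]; split=> [||g f].
- exact: positive_pushforward.
- by rewrite measure_of_pushforward preimage_setT.
- rewrite -[RHS]/(l (pullback _ f)) -[RHS](linv g).
  by rewrite -[LHS]/(l (pullback _ _)); congr (l _); exact: linfty_eqP.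
Qed.

Lemma invariant_means_fst (I : Type) (l : {linear linfty (G * I) R -> R^o}) :
  mean_on l -> invariant_means (pushforward fst l).
Proof.
move=> [lpos l1 linv]; apply/invariant_meansP; split=> [||g f].
- exact: positive_pushforward.
- by rewrite measure_of_pushforward preimage_setT.
- rewrite -[RHS]/(l (pullback _ f)) -[RHS](linv g).
  by rewrite -[LHS]/(l (pullback _ _)); congr (l _); exact: linfty_eqP.
Qed.

Lemma mean_on_pushforward (I J : Type) (h : G * I -> G * J)
    (l : {linear linfty (G * I) R -> R^o}) :
  (forall g s, h (act g s) = act g (h s)) -> mean_on l ->
  mean_on (pushforward h l).
Proof.
move=> hact [lpos l1 linv]; split=> [||g f].
- exact: positive_pushforward.
- by rewrite measure_of_pushforward preimage_setT.
- rewrite -[RHS]/(l (pullback h f)) -[RHS](linv g).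
  rewrite -[LHS]/(l (pullback h _)); congr (l _); apply: linfty_eqP => s.
  by rewrite -[LHS]/(f (act g (h s))) -hact.
Qed.

(** Every subset of B appears as a slice over some point of the second factor,
    which lets the choice of a subset of B be absorbed into the choice of an
    invariant mean. *)
Definition universal_subset B : set (G * set G) := [set s | B s.1 /\ s.2 s.1].

(** The strict inequality makes the maximal surplus positive, so that the
    maximizing X has positive measure. *)
Lemma density_iter_sumset_lt A B (K : R) (k : nat) :
  upper_Banach_density R (sumset A B) < K * upper_Banach_density R B ->
  0 < upper_Banach_density R B ->
  upper_Banach_density R (iter_sumset A k) <= K ^+ k * upper_Banach_density R B.
Proof.
move=> ABK B0.
have K0 : 0 < K.
  by rewrite -(pmulr_lgt0 _ B0); apply: le_lt_trans ABK; exact: density_ge0.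
have [lam lamm lamB] : exists2 lam, invariant_means lam &
    upper_Banach_density R (sumset A B) < K * measure_of lam B.
  have hs : has_sup [set (l (linfty_indic R B) : R) | l in @invariant_means R G].
    apply: contrapT => hs; have := B0.
    by rewrite /upper_Banach_density sup_out// ltxx.
  have e0 : 0 < upper_Banach_density R B - upper_Banach_density R (sumset A B) / K.
    by rewrite subr_gt0 ltr_pdivrMr// mulrC.
  have [_ [lam lamm <-]] := sup_adherent e0 hs.
  rewrite -/(upper_Banach_density R B) opprB addrC subrK => lamB.
  by exists lam => //; rewrite mulrC -ltr_pdivrMr.
(* l w is the surplus of X, now as a linear form in the mean l. *)
set X := universal_subset B.
pose w := K *: linfty_indic R X - linfty_indic R (thicken A X).
have wE (l : {linear linfty (G * set G) R -> R^o}) : l w = surplus l K A X.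
  by rewrite /w linearB linearZ.
(* The slice of X over the point B of the second factor is B itself, so this
   mean sees X as lam sees B and has positive surplus. *)
have lam'm := mean_on_section B lamm.
have [l lext lmax] := extreme_mean_maximizer w (ex_intro _ _ lam'm).
have [[lpos l1 linv] _] := lext.
have l0 : 0 < surplus l K A X.
  rewrite -wE; apply: lt_le_trans (lmax _ lam'm).
  rewrite wE /surplus !measure_of_pushforward subr_gt0.
  rewrite (_ : _ @^-1` X = B); last by apply/seteqP; split=> x //= -[].
  apply: le_lt_trans lamB; apply: le_trans (density_ge _ lamm).
  apply: le_measure_of; first by case/invariant_meansP: lamm.
  move=> x [a Aa [/= B1 _]]; exists a => //; exists (- a + x) => //.
  by rewrite addNKr.
have X0 : 0 < measure_of l X.
  rewrite -(pmulr_rgt0 _ K0); apply: lt_le_trans l0 _.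
  by rewrite /surplus gerBl; exact: measure_of_ge0.
have Xmax Z : Z `<=` X -> surplus l K A Z <= surplus l K A X.
  (* This map replaces the slice over each point by that of Z. *)
  move=> ZX; pose h (s : G * set G) := (s.1, [set y | Z (y, s.2)]).
  have hm : mean_on (pushforward h l) by exact: mean_on_pushforward.
  have hX : h @^-1` X = Z.
    apply/seteqP; split=> -[x Y]; first by case.
    by move=> Zx; split=> //=; case: (ZX _ Zx).
  have := lmax _ hm; rewrite !wE; apply: le_trans.
  rewrite /surplus !measure_of_pushforward hX.
  suff -> : h @^-1` thicken A X = thicken A Z by [].
  by rewrite -hX /thicken preimage_bigcup.
have XB : measure_of l X <= upper_Banach_density R B.
  apply: le_trans (density_ge B (invariant_means_fst (And3 lpos l1 linv))).
  by rewrite measure_of_pushforward; apply: le_measure_of => // s [].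
apply: density_le => [|eta /invariant_meansP[etapos eta1 etainv]].
  by rewrite mulr_ge0 ?exprn_ge0// ltW.
apply: le_trans (extreme_mean_covering etapos eta1 etainv lext X0 _) _.
  move=> F FA; apply: (measure_of_translates_le lpos linv (ltW K0) Xmax) FA.
by rewrite ler_wpM2l// exprn_ge0// ltW.
Qed.

(** Both sides are continuous in the constant, so K may be approached from
    above. *)
Lemma density_iter_sumset_le A B (K : R) (k : nat) :
  0 < upper_Banach_density R B ->
  upper_Banach_density R (sumset A B) <= K * upper_Banach_density R B ->
  upper_Banach_density R (iter_sumset A k) <= K ^+ k * upper_Banach_density R B.
Proof.
move=> B0 ABK.
have cvgK : (fun y : R => y ^+ k * upper_Banach_density R B) @ K^'+ -->
    K ^+ k * upper_Banach_density R B.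
  apply: cvgMl; apply: cvg_at_right_filter; exact: exprn_continuous.
apply: (cvgr_to_ge cvgK); near=> y.
apply: density_iter_sumset_lt => //; apply: le_lt_trans ABK _.
by rewrite ltr_pM2r//; near: y; exact: nbhs_right_gt.
Unshelve. all: by end_near. Qed.

(** When d*(B) = 0 and k = 1, the second factor is 0 to the power 0, which is
    1, and the claim is that adding a nonempty set does not decrease the
    density. *)
Lemma density_sumset_root A B (k : nat) : (0 < k)%N -> (k = 1%N -> B !=set0) ->
  upper_Banach_density R (iter_sumset A k) `^ (k%:R^-1)
    * upper_Banach_density R B `^ (1 - k%:R^-1)
  <= upper_Banach_density R (sumset A B).
Proof.
move=> k0 kB; have kR : 0 < k%:R :> R by rewrite ltr0n.
have [B0|] := ltP 0 (upper_Banach_density R B); last first.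
  move=> B0; have {B0} B0 : upper_Banach_density R B = 0.
    by apply/eqP; rewrite eq_le B0 density_ge0.
  have [k1|k1] := eqVneq k 1%N.
    rewrite k1 invr1 subrr powRr0 mulr1 powRr1 ?density_ge0//.
    rewrite /iter_sumset /= (_ : sumset A [set 0] = A); last first.
      apply/seteqP; split=> [_ [a Aa [_ -> <-]]|a Aa]; first by rewrite addr0.
      by exists a => //; exists 0 => //; rewrite addr0.
    exact/density_sumset_ge/kB.
  rewrite B0 powR0 ?mulr0 ?density_ge0//.
  by rewrite subr_eq0 eq_sym invr_eq1 pnatr_eq1.
set a := upper_Banach_density R (sumset A B).
set b := upper_Banach_density R B in B0 *.
have a0 : 0 <= a by exact: density_ge0.
have ab0 : 0 <= a / b by rewrite divr_ge0// ltW.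
have abK : a <= a / b * b by rewrite divfK// gt_eqF.
have := density_iter_sumset_le (K := a / b) k B0 abK.
rewrite -/b => kAle.
have : upper_Banach_density R (iter_sumset A k) `^ (k%:R^-1) <=
    ((a / b) ^+ k * b) `^ (k%:R^-1).
  apply: ge0_ler_powR; rewrite ?nnegrE ?density_ge0 ?invr_ge0 ?ler0n//.
  by rewrite mulr_ge0 ?exprn_ge0// ltW.
rewrite powRM ?exprn_ge0 ?(ltW B0)// -powR_mulrn// -powRrM mulfV ?gt_eqF//.
rewrite powRr1// => le.
apply: le_trans (ler_wpM2r (powR_ge0 _ _) le) _.
rewrite -(mulrA (a / b)) -powRD; last by rewrite (gt_eqF B0) implybT.
by rewrite (addrC k%:R^-1) subrK powRr1 ?(ltW B0)// divfK// gt_eqF.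
Qed.

End UpperDensity.

Unset Implicit Arguments.

Theorem corollary1p2 (R : realType) (G : zmodType)
    (countable_G : countable [set: G]) :
  (forall (A B : set G) (K : R),
     0 < upper_Banach_density R B ->
     upper_Banach_density R (sumset A B) <= K * upper_Banach_density R B ->
     forall k : nat, (1 <= k)%N ->
       upper_Banach_density R (iter_sumset A k)
         <= K ^+ k * upper_Banach_density R B)
  /\
  (forall k : nat, (1 <= k)%N ->
     forall A B : set G, (k = 1%N -> B !=set0) ->
       upper_Banach_density R (iter_sumset A k) `^ (k%:R^-1)
         * upper_Banach_density R B `^ (1 - k%:R^-1)
       <= upper_Banach_density R (sumset A B)).
Proof.
split=> [A B K B0 ABK k _|k k0 A B kB]; first exact: density_iter_sumset_le.
exact: density_sumset_root.
Qed.
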